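(* Let $X$ be a separable real Banach space containing no subspace isomorphic to $\ell_1$, let $(\Gamma,\preceq)$ be a directed set, and let $F\colon\Gamma\to X$ be a bounded function. Then for every $\sigma(X^{**},X^* )$-limit point $x^{**}$ of the function $F$ there is a strictly increasing sequence $\gamma(1)\preceq\gamma(2)\preceq\cdots$ in $\Gamma$ such that $\bigl(F(\gamma(n))\bigr)$ converges to $x^{**}$ in $\sigma(X^{**},X^* )$.
   Context: $X$ is regarded as a subspace of its bidual $X^{**}$; $\sigma(X^{**},X^* )$ is the weak$^*$ topology of $X^{**}$. A directed set is a nonempty set with a reflexive transitive relation $\preceq$ such that any two elements have a common upper bound. An element $x^{**}\in X^{**}$ is a $\sigma(X^{**},X^* )$-limit point of $F$ if for every $\gamma_0\in\Gamma$ and every $\sigma(X^{**},X^* )$-neighbourhood $U$ of $x^{**}$ there is $\gamma\in\Gamma$ with $\gamma_0\preceq\gamma$ and $F(\gamma)\in U$. A sequence $(\gamma(n))$ in $\Gamma$ is strictly increasing if $\gamma(n)\preceq\gamma(n+1)$ and not $\gamma(n+1)\preceq\gamma(n)$ for all $n$.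
   Formalization: The directed set is additionally assumed to have no greatest element (no element above all others); otherwise the claim fails, e.g. for a one-point directed set, where no strictly increasing sequence exists. *)

(* Defs.v *)
From HB Require Import structures.
From mathcomp Require Import all_boot all_order all_algebra.
From mathcomp Require Import all_classical all_reals all_analysis.

Set Implicit Arguments.
Unset Strict Implicit.
Unset Printing Implicit Defensive.

Import Order.TTheory GRing.Theory Num.Theory.
Import numFieldNormedType.Exports.

Local Open Scope classical_set_scope.
Local Open Scope ring_scope.

Section Dual.
Context {R : realType} {X : normedModType R}.

Definition dual_pred : {pred X -> R^o} :=
  [pred f : X -> R^o | `[< linear f /\ continuous f >]].

Record dual_space := DualSpace {
  dual_fun :> X -> R^o;
  _ : dual_fun \in dual_pred }.

HB.instance Definition _ := [isSub for dual_fun].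
HB.instance Definition _ := [Choice of dual_space by <:].

Lemma dual_submod_closed : submod_closed dual_pred.
Proof.
split.
  apply/asboolP; split; first by move=> a x y /=; rewrite scaler0 addr0.
  exact: cst_continuous.
move=> a f g /asboolP[lf cf] /asboolP[lg cg]; apply/asboolP; split.
  move=> b x y.
  change (a *: f (b *: x + y) + g (b *: x + y) =
    b *: (a *: f x + g x) + (a *: f y + g y)).
  by rewrite lf lg !scalerDr !scalerA (mulrC a b) addrACA.
move=> x; apply: continuousD; last exact: cg.
by apply: cvgZl_tmp; exact: cf.
Qed.

HB.instance Definition _ :=
  GRing.isSubmodClosed.Build R (X -> R^o) dual_pred dual_submod_closed.
HB.instance Definition _ := [SubChoice_isSubLmodule of dual_space by <:].

Lemma dual_linear (f : dual_space) : linear (f : X -> R^o).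
Proof. by case: f => f /= /asboolP[]. Qed.

Lemma dual_continuous (f : dual_space) : continuous (f : X -> R^o).
Proof. by case: f => f /= /asboolP[]. Qed.

HB.instance Definition _ (f : dual_space) :=
  GRing.isLinear.Build R X R^o *:%R (dual_fun f) (@dual_linear f).

Definition dual_norm (f : dual_space) : R :=
  sup [set `|f x| | x in [set x : X | `|x| <= 1]].

Lemma dual_norm_has_sup (f : dual_space) :
  has_sup [set `|f x| | x in [set x : X | `|x| <= 1]].
Proof.
split; first by exists `|f 0|; exists 0 => //=; rewrite normr0.
have /linear_bounded_continuous/linear_boundedP := @dual_continuous f.
move=> /pinfty_ex_gt0[r r0 fr]; exists r => _ [x /= x1 <-].
by rewrite (le_trans (fr x))// ler_piMr// ltW.
Qed.

Lemma dual_norm_ub (f : dual_space) x : `|x| <= 1 -> `|f x| <= dual_norm f.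
Proof.
by move=> x1; apply: (ub_le_sup (dual_norm_has_sup f).2); exists x.
Qed.

Lemma dual_norm_ge0 (f : dual_space) : 0 <= dual_norm f.
Proof. by rewrite (le_trans (normr_ge0 (f 0)))// dual_norm_ub// normr0. Qed.

Lemma le_dual_norm (f : dual_space) x : `|f x| <= dual_norm f * `|x|.
Proof.
have [->|x0] := eqVneq x 0; first by rewrite linear0 !normr0 mulr0.
rewrite -ler_pdivrMr ?normr_gt0//.
have -> : `|f x| / `|x| = `|f (`|x|^-1 *: x)|.
  by rewrite linearZ normrZ normfV normr_id mulrC.
by apply: dual_norm_ub; rewrite normrZ normfV normr_id mulVf// normr_eq0.
Qed.

Lemma dual_norm_le (f : dual_space) M :
  (forall x, `|x| <= 1 -> `|f x| <= M) -> dual_norm f <= M.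
Proof.
move=> fM; apply: ge_sup; first exact: (dual_norm_has_sup f).1.
by move=> _ [x /= x1 <-]; exact: fM.
Qed.

Let dual_normD f g : dual_norm (f + g) <= dual_norm f + dual_norm g.
Proof.
apply: dual_norm_le => x x1; rewrite (_ : (f + g) x = f x + g x)//.
by rewrite (le_trans (ler_normD _ _))// lerD// dual_norm_ub.
Qed.

Let dual_normZ_le (a : R) f : dual_norm (a *: f) <= `|a| * dual_norm f.
Proof.
apply: dual_norm_le => x x1; rewrite (_ : (a *: f) x = a *: f x)//.
by rewrite normrZ ler_wpM2l// dual_norm_ub.
Qed.

Let dual_normZ (a : R) f : dual_norm (a *: f) = `|a| * dual_norm f.
Proof.
apply/eqP; rewrite eq_le dual_normZ_le/=.
have [->|a0] := eqVneq a 0; first by rewrite normr0 mul0r dual_norm_ge0.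
rewrite -ler_pdivlMl ?normr_gt0// -normfV.
by rewrite -{1}(scale1r f) -(mulVf a0) -scalerA dual_normZ_le.
Qed.

Let dual_norm0 f : dual_norm f = 0 -> f = 0.
Proof.
move=> f0; apply: val_inj; apply/funext => x /=; apply/eqP.
by rewrite -normr_le0 (le_trans (le_dual_norm f x))// f0 mul0r.
Qed.

HB.instance Definition _ := Lmodule_isNormed.Build R dual_space
  dual_normD dual_normZ dual_norm0.

End Dual.
Arguments dual_space {R} X.

Lemma dual_normE {R : realType} {X : normedModType R} (f : dual_space X) :
  `|f| = dual_norm f.
Proof. by []. Qed.

(* weak_star X is the dual of X with sigma(X^*, X): the topology that it
   inherits from pointwise convergence of functions on X. *)
Definition weak_star {R : realType} (X : normedModType R) : Type :=
  initial_topology (dual_fun : dual_space X -> {ptws X -> R^o}).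

HB.instance Definition _ {R : realType} (X : normedModType R) :=
  Topological.copy (weak_star X)
    (initial_topology (dual_fun : dual_space X -> {ptws X -> R^o})).

Section CanonicalEmbedding.
Context {R : realType} {X : normedModType R}.

Lemma bidual_embed_subproof (x : X) :
  (fun f : dual_space X => f x) \in @dual_pred R (dual_space X).
Proof.
pose ev := fun f : dual_space X => (f x : R^o).
have lev : linear ev by [].
pose L : {linear dual_space X -> R^o} :=
  HB.pack ev (GRing.isLinear.Build _ _ _ _ _ lev).
apply/asboolP; split => //.
apply/(linear_bounded_continuous L)/linear_boundedP.
near=> r => f; rewrite (le_trans (le_dual_norm f x))// mulrC.
apply: ler_wpM2r; first exact: dual_norm_ge0.
by near: r; apply: nbhs_pinfty_ge; exact: num_real.
Unshelve. all: by end_near. Qed.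

Definition bidual_embed (x : X) : dual_space (dual_space X) :=
  DualSpace (bidual_embed_subproof x).

(* The same map, with the bidual carrying sigma(X^**, X^* ). *)
Definition weak_star_embed : X -> weak_star (dual_space X) := bidual_embed.

End CanonicalEmbedding.

Section Ell1.
Context {R : realType}.

Definition ell1_pred : {pred nat -> R^o} :=
  [pred a : nat -> R^o | `[< cvgn (series (fun n => `|a n|)) >]].

Record ell1 := Ell1 {
  ell1_fun :> nat -> R^o;
  _ : ell1_fun \in ell1_pred }.

HB.instance Definition _ := [isSub for ell1_fun].
HB.instance Definition _ := [Choice of ell1 by <:].

Lemma ell1_submod_closed : submod_closed ell1_pred.
Proof.
split.
  apply/asboolP; rewrite (_ : (fun n => _) = 0 :> (nat -> R^o)).
    rewrite (_ : series _ = cst 0); first exact: is_cvg_cst.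
    by apply/funext => n; rewrite /series/= big1.
  by apply/funext => n /=; rewrite normr0.
move=> c a b /asboolP ca /asboolP cb; apply/asboolP.
apply: (@series_le_cvg R _ (`|c| *: (fun n => `|a n|) + (fun n => `|b n|))).
- by move=> n.
- by move=> n; apply: addr_ge0 => //; apply: mulr_ge0.
- by move=> n; rewrite (le_trans (ler_normD _ _))// lerD2r normrZ.
- by apply: is_cvg_seriesD => //; exact: is_cvg_seriesZ.
Qed.

HB.instance Definition _ :=
  GRing.isSubmodClosed.Build R (nat -> R^o) ell1_pred ell1_submod_closed.
HB.instance Definition _ := [SubChoice_isSubLmodule of ell1 by <:].

Lemma ell1_cvg (a : ell1) : cvgn (series (fun n => `|a n|)).
Proof. by case: a => a /= /asboolP. Qed.

Definition ell1_norm (a : ell1) : R := limn (series (fun n => `|a n|)).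

Let ell1_normD a b : ell1_norm (a + b) <= ell1_norm a + ell1_norm b.
Proof.
rewrite /ell1_norm -lim_seriesD; [|exact: ell1_cvg..].
apply: lim_series_le; first exact: ell1_cvg.
  by apply: is_cvg_seriesD; exact: ell1_cvg.
by move=> n; exact: ler_normD.
Qed.

Let ell1_normZ (c : R) a : ell1_norm (c *: a) = `|c| * ell1_norm a.
Proof.
rewrite /ell1_norm -[RHS]/(`|c| *: (_ : R^o)) -lim_seriesZ; last exact: ell1_cvg.
by congr (limn (series _)); apply/funext => n; exact: normrM.
Qed.

Let ell1_norm0 a : ell1_norm a = 0 -> a = 0.
Proof.
move=> a0; apply: val_inj; apply/funext => n /=; apply/eqP.
rewrite -normr_le0 -a0.
apply: (@le_trans _ _ (series (fun k => `|a k|) n.+1)).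
  by rewrite /series/= big_nat_recr//= lerDr sumr_ge0.
apply: nondecreasing_cvgn_le; last exact: ell1_cvg.
by apply/nondecreasing_series => k _ _.
Qed.

HB.instance Definition _ := Lmodule_isNormed.Build R ell1
  ell1_normD ell1_normZ ell1_norm0.

End Ell1.
Arguments ell1 R : clear implicits.

(* The range of such a T is the subspace isomorphic to ell_1; a linear
   bijection between normed spaces is an isomorphism exactly when it is bounded
   above and below. *)
Definition contains_ell1 {R : realType} (X : normedModType R) :=
  exists T : {linear ell1 R -> X}, exists c C : R,
    [/\ 0 < c, 0 < C & forall a, c * `|a| <= `|T a| <= C * `|a|].

Definition separable_space (T : topologicalType) :=
  exists D : set T, countable D /\ dense D.

Definition directed_set (I : Type) (le : I -> I -> Prop) :=
  [/\ inhabited I,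
      forall i, le i i,
      forall i j k, le i j -> le j k -> le i k &
      forall i j, exists k, le i k /\ le j k].

Definition has_greatest (I : Type) (le : I -> I -> Prop) :=
  exists j, forall i, le i j.

Definition strictly_increasing (I : Type) (le : I -> I -> Prop) (g : nat -> I) :=
  forall n, le (g n) (g n.+1) /\ ~ le (g n.+1) (g n).

Definition net_limit_point (I : Type) (le : I -> I -> Prop) (T : topologicalType)
    (F : I -> T) (p : T) :=
  forall i0 (U : set T), nbhs p U -> exists i, le i0 i /\ U (F i).

(* Main.v *)
Require Import Defs.
From HB Require Import structures.
From mathcomp Require Import all_boot all_order all_algebra.
From mathcomp Require Import all_classical all_reals all_analysis.
From mathcomp Require Import lra.

Set Implicit Arguments.
Unset Strict Implicit.
Unset Printing Implicit Defensive.

Import Order.TTheory GRing.Theory Num.Theory.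
Import numFieldNormedType.Exports.

Local Open Scope classical_set_scope.
Local Open Scope ring_scope.

(** Fix an ultrafilter [U] on the directed set that contains every tail and
    along which [F] converges weak-star to [x]; it exists because [x] is a limit
    point. A strategy assigns to every finite sequence of indices a [U]-large
    set of admissible next indices. Call a set [A] of functionals in the unit
    ball of the dual eps-thin when some strategy forces, along every sequence
    that obeys it, [phi (F (g k)) <= x phi + eps] eventually, for every [phi]
    in [A].

    Countably many strategies can be obeyed together, the n-th one from step n
    on ([strategy_fusion]), and the requirement that the sequence be strictly
    increasing is itself a strategy, since there is no greatest element. Hence
    if the whole ball is eps-thin for every eps > 0, one sequence is strictly
    increasing and satisfies all the upper estimates; the ball being symmetric,
    these give weak-star convergence to [x].

    It remains to see that the ball is eps-thin when [X] is separable without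
    a copy of ell_1. Fusion shows that thin sets form a sigma-ideal. If [A] is
    not thin then, for [U]-many indices [i], both the part of [A] on which
    [phi (F i) > x phi + eps] and the part on which [phi (F i) < x phi + delta]
    are again not thin ([nonthin_above], [nonthin_below]): if the first parts
    were thin for [U]-many [i], a strategy could wait for the first violation of
    the estimate and then switch to the strategy of the part where it happened;
    if the second parts were thin for [U]-many [i], then, since these cover [A]
    with room to spare, separability of [X] would cover [A] by countably many
    of them. Starting from a set on which [x] is
    almost constant and splitting repeatedly, at each step with one index that
    serves the finitely many parts present, one obtains a sequence
    [F (m 0), F (m 1), ...] all of whose finite above/below patterns are realised
    by functionals of the ball ([nonthin_independent]). By Rosenthal's
    computation such a sequence is equivalent to the unit vector basis of
    ell_1. *)

(** * Strategies for choosing sequences of indices *)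

Section Strategies.
Variable I : Type.
Implicit Types (Phi : seq I -> set I) (g : nat -> I).

Definition follows Phi g := forall k, Phi (mkseq g k) (g k).

Lemma mkseqD g i k :
  mkseq g (i + k) = mkseq g i ++ mkseq (fun j => g (i + j)%N) k.
Proof.
rewrite /mkseq iotaD map_cat add0n; congr (_ ++ _).
by rewrite -[in LHS](addn0 i) iotaDl -map_comp.
Qed.

Lemma exists_follows Phi : (forall s, Phi s !=set0) -> exists g, follows Phi g.
Proof.
move=> /choice[c Phic].
pose h n := iter n (fun s => rcons s (c s)) [::].
exists (fun n => c (h n)) => k.
suff -> : mkseq (fun n => c (h n)) k = h k by exact: Phic.
by elim: k => // k IHk; rewrite mkseqS IHk.
Qed.

Variable U : set_system I.
Context {FU : Filter U}.

(** A strategy may open a new strategy [W p] after each initial segment [p] of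
    the play and obey all those opened so far: at any moment they are finitely
    many, so the common moves still form a member of the filter. *)
Lemma strategy_fusion (W : seq I -> seq I -> set I) :
  (forall p s, U (W p s)) ->
  exists Phi, (forall s, U (Phi s)) /\
    forall g, follows Phi g ->
      forall i, follows (W (mkseq g i)) (fun k => g (i + k)%N).
Proof.
move=> UW.
exists (fun s => [set a | forall i : 'I_(size s).+1, W (take i s) (drop i s) a]).
split=> [s|g Phig i k].
  by apply: filter_forall => i; exact: UW.
have ik : (i < (size (mkseq g (i + k))).+1)%N.
  by rewrite size_mkseq ltnS leq_addr.
have := Phig (i + k)%N (Ordinal ik).
by rewrite /= mkseqD take_size_cat ?size_mkseq// drop_size_cat ?size_mkseq.
Qed.

End Strategies.

Lemma eventually_shift i (P : nat -> Prop) :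
  (\forall k \near \oo, P (i + k)%N) -> \forall k \near \oo, P k.
Proof.
case=> N _ NP; exists (i + N)%N => // k /= iNk.
rewrite -(subnKC (leq_trans (leq_addr N i) iNk)); apply: NP => /=.
by rewrite leq_subRL// (leq_trans (leq_addr N i)).
Qed.

(** * Thin sets and independent sequences *)

Section Dichotomy.
Context {R : realType} {I T : Type} (U : set_system I) {UU : UltraFilter U}.
Variables (v : I -> T -> R) (f : T -> R).
Hypothesis vf : forall t, v ^~ t @ U --> f t.
(* Separability of the family [v] for uniform distance, as a colouring with
   countably many colours: it avoids naming a dense sequence, which would not
   be indexed by [I]. *)
Hypothesis v_separable : forall delta, 0 < delta ->
  exists c : I -> nat, forall i j t, c i = c j -> v i t < v j t + delta.
Implicit Types (A B : set T) (eps : R).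

Let PU : ProperFilter U := ultra_proper.
Local Existing Instance PU.

(** The estimate is one-sided so that its failure has a sign, which is what an
    independent sequence needs. *)
Definition thin eps A := exists Phi : seq I -> set I,
  (forall s, U (Phi s)) /\
  forall g, follows Phi g ->
    forall t, A t -> \forall k \near \oo, v (g k) t <= f t + eps.

Lemma thin0 eps : thin eps set0.
Proof. by exists (fun=> setT); split=> // s; exact: filterT. Qed.

Lemma sub_thin eps A B : A `<=` B -> thin eps B -> thin eps A.
Proof.
move=> AB [Phi [UPhi Bthin]]; exists Phi; split=> // g Phig t /AB.
exact: Bthin.
Qed.

Lemma nonthin_neq0 eps A : ~ thin eps A -> A !=set0.
Proof.
by move=> nA; apply/set0P/eqP => A0; apply: nA; rewrite A0; exact: thin0.
Qed.

(** The strategy attached to the [j]-th piece only has to be obeyed from step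
    [pickle j] on, because thinness is a statement about tails. *)
Lemma thin_countable_cover (J : countType) eps A (B : J -> set T) :
  (forall j, thin eps (B j)) -> A `<=` \bigcup_j B j -> thin eps A.
Proof.
move=> /choice[Psi Psithin] AB.
pose W (p : seq I) := if unpickle (size p) is Some j then Psi j else fun=> setT.
have [p s|Phi [UPhi PhiW]] := @strategy_fusion I U _ W.
  rewrite /W; case: unpickle => [j|]; last exact: filterT.
  exact: (Psithin j).1.
exists Phi; split=> // g /PhiW gW t /AB[j _ Bjt].
apply: (@eventually_shift (pickle j)).
apply: (Psithin j).2 => //.
by have := gW (pickle j); rewrite /W size_mkseq pickleK.
Qed.

Lemma ultra_not (P : I -> Prop) : ~ U [set i | P i] -> U [set i | ~ P i].
Proof. by case: (in_ultra_setVsetC [set i | P i] UU). Qed.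

(** Otherwise the parts are thin for [U]-many [i], and [A] itself is thin: play
    such indices and, after each move [i], also obey from then on a strategy
    for the part cut out by [i]. A point of [A] either never violates the
    estimate, or lies in the part of its first violator, whose strategy takes
    care of it. *)
Lemma nonthin_above eps A : ~ thin eps A ->
  U [set i | ~ thin eps (A `&` [set t | f t + eps < v i t])].
Proof.
move=> nA; apply: contrapT => /ultra_not; rewrite (_ : [set i | _] =
  [set i | thin eps (A `&` [set t | f t + eps < v i t])]); last first.
  by apply/seteqP; split=> i /=; [exact: contrapT|move=> ? []].
set G := [set i | _] => UG; apply: nA.
have /choice[Psi Psithin] : forall i, exists Psi : seq I -> set I,
    (forall s, U (Psi s)) /\ (G i -> forall g, follows Psi g ->
      forall t, A t -> f t + eps < v i t ->
        \forall k \near \oo, v (g k) t <= f t + eps).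
  move=> i; have [Gi|nGi] := pselect (G i).
    have [Psi [UPsi Psit]] := Gi; exists Psi; split=> // _ g gPsi t At fv.
    exact: Psit.
  by exists (fun=> setT); split=> // s; exact: filterT.
(* The strategy opened after [p] depends on the last move of [p] only; the one
   opened at the start keeps all the moves in [G]. *)
pose W p : seq I -> set I := if rev p is i :: _ then Psi i else fun=> G.
have [p s|Phi [UPhi PhiW]] := @strategy_fusion I U _ W.
  by rewrite /W; case: (rev p) => // i _; exact: (Psithin i).1.
exists Phi; split=> // g /PhiW gW t At.
have [[i vi]|nvi] := pselect (exists i, f t + eps < v (g i) t); last first.
  apply: nearW => k; rewrite leNgt; apply/negP => vk; apply: nvi.
  by exists k.
apply: (@eventually_shift i.+1).
have Ggi : G (g i) by have := gW 0%N i; rewrite /W.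
apply: ((Psithin (g i)).2 Ggi) => //.
by have := gW i.+1; rewrite /W mkseqS rev_rcons.
Qed.

(** Otherwise the parts are thin for [U]-many [i]; every point of [A] lies in
    one of them, even with [delta / 2] for [delta], by convergence along [U];
    one representative per colour at distance [delta / 2] then suffices to
    cover [A]. *)
Lemma nonthin_below eps delta A : 0 < delta -> ~ thin eps A ->
  U [set i | ~ thin eps (A `&` [set t | v i t < f t + delta])].
Proof.
move=> delta0 nA; apply: contrapT => /ultra_not; rewrite (_ : [set i | _] =
  [set i | thin eps (A `&` [set t | v i t < f t + delta])]); last first.
  by apply/seteqP; split=> i /=; [exact: contrapT|move=> ? []].
set G := [set i | _] => UG; apply: nA.
have delta20 : 0 < delta / 2 by rewrite divr_gt0.
have [c cv] := v_separable delta20.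
pose B n := [set t | exists i,
  [/\ G i, c i = n, A t & v i t < f t + delta / 2]].
apply: (@thin_countable_cover nat _ _ B) => [n|t At].
  have [[j [Gj cj]]|nG] := pselect (exists j, G j /\ c j = n).
    apply: sub_thin Gj => t [i [_ ci At vi]]; split=> //=.
    have := cv j i t; rewrite ci cj => /(_ erefl); lra.
  apply: sub_thin (thin0 eps) => t [i [Gi ci _ _]]; apply: nG.
  by exists i.
have /filter_ex[i [Gi vi]] : U (G `&` [set i | v i t < f t + delta / 2]).
  apply: filterI => //; apply: (cvgr_lt (f t) (@vf t)).
  by rewrite ltrDl.
by exists (c i) => //; exists i.
Qed.

(** Rosenthal's independence of the pairs of sets [v (m i) > b], [v (m i) < a],
    for finite patterns: [P i] says on which side of the gap index [i] lies. *)
Definition independent (a b : R) (m : nat -> I) :=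
  forall (n : nat) (P : nat -> bool), exists t, forall i, (i < n)%N ->
    if P i then b < v (m i) t else v (m i) t < a.

(** On a slice where [f] varies by less than [eps / 4], the two moving thresholds
    [f t + eps] and [f t + eps / 4] are separated by a fixed gap. The sequence
    is built by keeping all the cells of the partition generated by the indices
    chosen so far non-thin. *)
Lemma nonthin_independent eps : 0 < eps -> ~ thin eps setT ->
  exists a b m, a < b /\ independent a b m.
Proof.
move=> eps0 nthin.
pose d := eps / 4.
have d0 : 0 < d by rewrite divr_gt0.
pose slice (j : int) := [set t | j%:~R * d <= f t < (j + 1)%:~R * d].
have [j nthinj] : exists j, ~ thin eps (slice j).
  apply: contrapT => /forallNP nj; apply: nthin.
  apply: (@thin_countable_cover int _ _ slice) => [j|t _].
    exact: contrapT (nj j).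
  exists (Num.floor (f t / d)) => //=.
  by rewrite /slice /= -ler_pdivlMr// -ltr_pdivrMr// floor_itv.
pose half (b : bool) i t : bool :=
  if b then f t + eps < v i t else v i t < f t + d.
pose cell bs s :=
  slice j `&` [set t | all (fun p => half p.1 p.2 t) (zip bs s)].
pose Q (s : seq I) := forall bs, size bs = size s -> ~ thin eps (cell bs s).
have Qext s : Q s -> U [set i | Q (rcons s i)].
  move=> Qs.
  have : \forall i \near U, forall p : (size s).-tuple bool * bool,
      ~ thin eps (cell p.1 s `&` [set t | half p.2 i t]).
    apply: filter_forall => -[bs [] /=].
      by apply: nonthin_above; apply: Qs; rewrite size_tuple.
    by apply: nonthin_below => //; apply: Qs; rewrite size_tuple.
  apply: filterS => i Pi bs; case/lastP: bs => [|bs b].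
    by rewrite size_rcons.
  rewrite !size_rcons => -[sbs].
  have := Pi (Tuple (introT eqP sbs), b); apply: contra_not.
  apply: sub_thin => t [[jt hbs] hb]; split=> //=.
  by rewrite zip_rcons// all_rcons /= hb.
have [|m mQ] := @exists_follows I (fun s => [set i | Q s -> Q (rcons s i)]).
  move=> s; have [Qs|nQs] := pselect (Q s).
    by have [i Qi] := filter_ex (Qext s Qs); exists i.
  by have [i _] := filter_ex (filterT : U setT); exists i => /nQs.
have Qm n : Q (mkseq m n).
  elim: n => [|n IHn]; last by rewrite mkseqS; exact: mQ.
  case=> // _; apply: contra_not nthinj; apply: sub_thin => t jt.
  by split.
exists ((j + 1)%:~R * d + d), (j%:~R * d + eps), m; split.
  rewrite intrD mulrDl mul1r /d; lra.
move=> n P.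
have [|t [/andP[jf fj]]] := nonthin_neq0 (Qm n (mkseq P n) _).
  by rewrite !size_mkseq.
rewrite /= /mkseq zip_map all_map => /allP hP.
exists t => i ni; have /= := hP i; rewrite mem_iota /= add0n => /(_ ni).
by rewrite /half; case: (P i) => vf'; lra.
Qed.

End Dichotomy.

(** * Convergence in the weak-star topology *)

Section WeakStar.
Context {R : realType} {Y : normedModType R}.

Lemma weak_star_eval_cvg (y : weak_star Y) (phi : Y) :
  (fun z : weak_star Y => dual_fun z phi) @ nbhs y --> dual_fun y phi.
Proof.
have : {ptws, (dual_fun : weak_star Y -> (Y -> R^o)) @ nbhs y --> dual_fun y}.
  exact: (@initial_continuous _ _
    (dual_fun : dual_space Y -> {ptws Y -> R^o}) y).
by move=> /pointwise_cvgP /(_ phi).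
Qed.

Lemma weak_star_cvgP (S : Type) (G : set_system S) {FG : Filter G}
    (h : S -> weak_star Y) (y : weak_star Y) :
  h @ G --> y <->
  forall phi, (fun s => dual_fun (h s) phi) @ G --> dual_fun y phi.
Proof.
split=> [hy phi|hy].
  exact: (cvg_comp _ _ hy (@weak_star_eval_cvg y phi)).
have hptws : {ptws, (fun s => dual_fun (h s) : Y -> R^o) @ G --> dual_fun y}.
  by apply/pointwise_cvgP => phi; exact: hy.
move=> A /= [_ [[B Bop <-] By sBA]].
apply: (filterS sBA); apply: hptws.
by rewrite nbhsE; exists B.
Qed.

End WeakStar.

(** One-sided estimates on the unit ball suffice: applied to a multiple of a
    functional and to its opposite they become two-sided. *)
Lemma weak_star_embed_cvg (R : realType) (X : normedModType R)
    (h : nat -> X) (x : weak_star (dual_space X)) :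
  (forall eps, 0 < eps -> forall phi : dual_space X, `|phi| <= 1 ->
    \forall k \near \oo, phi (h k) <= dual_fun x phi + eps) ->
  weak_star_embed \o h @ \oo --> x.
Proof.
move=> hx; apply/weak_star_cvgP => phi; apply/cvgrPdist_le => eps eps0.
pose c := `|phi| + 1; pose x' : dual_space (dual_space X) := x.
have c0 : 0 < c by rewrite ltr_wpDl.
pose psi := c^-1 *: phi.
have psi1 : `|psi| <= 1.
  rewrite normrZ normfV gtr0_norm// mulrC ler_pdivrMr// mul1r.
  by rewrite lerDl.
have phiE (z : X) : phi z = c * psi z.
  by rewrite -[psi z]/(c^-1 * phi z) mulrA mulfV ?mul1r ?gt_eqF.
have xphiE : x' phi = c * x' psi.
  by rewrite linearZ/= -[_ *: _]/(c^-1 * _) mulrA mulfV ?mul1r ?gt_eqF.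
have xpsiN : x' (- psi) = - x' psi by rewrite linearN.
have epsc : 0 < eps / c by rewrite divr_gt0.
have Npsi1 : `|- psi| <= 1 by rewrite normrN.
apply: filterS2 (hx _ epsc _ psi1) (hx _ epsc _ Npsi1) => k.
rewrite -[dual_fun x psi]/(x' psi) -[dual_fun x (- psi)]/(x' (- psi)) xpsiN.
rewrite -[(- psi) (h k)]/(- psi (h k)) => up lo.
rewrite -[X in `|X|]/(x' phi - phi (h k)) xphiE phiE -mulrBr normrM.
rewrite gtr0_norm// -ler_pdivlMl// mulrC.
by rewrite ler_norml; apply/andP; split; lra.
Qed.

(** * Copies of ell_1 *)

Section Ell1Embedding.
Context {R : realType} {X : completeNormedModType R}.
Variables (y : nat -> X) (M c : R).
Hypothesis yM : forall n, `|y n| <= M.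
Hypothesis c0 : 0 < c.
Hypothesis ly : forall (a : nat -> R) n,
  c * (\sum_(0 <= i < n) `|a i|) <= `|\sum_(0 <= i < n) a i *: y i|.

Let term (a : ell1 R) n : X := (a n : R) *: y n.

Let M0 : 0 <= M. Proof. exact: le_trans (yM 0). Qed.

Let cvg_normed_term a : cvgn [normed series (term a)].
Proof.
apply: (@series_le_cvg R _ (fun n => M *: (`|a n| : R^o))) => [n|n|n|] //.
- exact: normr_ge0.
- by apply: mulr_ge0.
- by rewrite /= /term normrZ -[_ *: _]/(M * _) mulrC ler_wpM2r.
- by apply: is_cvg_seriesZ; exact: ell1_cvg.
Qed.

Let cvg_term a : cvgn (series (term a)).
Proof. exact: normed_cvg. Qed.

Let synth (a : ell1 R) : X := limn (series (term a)).

Let synth_linear : linear synth.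
Proof.
move=> k a b; apply: cvg_lim; first exact: norm_hausdorff.
rewrite (_ : series _ = k \*: series (term a) + series (term b)).
  apply: cvgD; last exact: cvg_term.
  by apply: cvgZl_tmp; exact: cvg_term.
apply/funext => n; rewrite -[RHS]/(k *: series (term a) n + series (term b) n).
rewrite /series/= scaler_sumr -big_split/=; apply: eq_bigr => i _.
by rewrite /term scalerA -scalerDl.
Qed.

(** The upper ell_1 estimate is the triangle inequality, so the lower one makes
    [a |-> \sum_n a_n y_n] an isomorphism onto its range. *)
Lemma contains_ell1_lower_estimate : contains_ell1 X.
Proof.
pose T : {linear ell1 R -> X} :=
  HB.pack synth (GRing.isLinear.Build _ _ _ _ _ synth_linear).
have M10 : 0 < M + 1 by rewrite ltr_wpDl.
exists T, c, (M + 1); split=> // a.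
have a_lim : series (fun n => `|a n|) @ \oo --> `|a|.
  exact: ell1_cvg.
have T_lim : (fun n => `|series (term a) n|) @ \oo --> `|T a|.
  by apply: cvg_norm; exact: cvg_term.
apply/andP; split.
  apply: (ler_cvg_to (@cvgMl_tmp _ _ _ _ _ c _ a_lim) T_lim).
  by apply: nearW => n; rewrite /= ly.
apply: (ler_cvg_to T_lim (@cvgMl_tmp _ _ _ _ _ (M + 1) _ a_lim)).
apply: nearW => n /=; rewrite /series /= mulr_sumr.
apply: (le_trans (ler_norm_sum _ _ _)); apply: ler_sum => i _.
rewrite /term normrZ mulrC ler_wpM2r// (le_trans (yM i))//.
by rewrite lerDl.
Qed.

End Ell1Embedding.

(** Rosenthal's computation: take a functional above the gap exactly where the
    coefficients are nonnegative, and one with the opposite pattern. The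
    difference of their values at the combination is at least
    [(b - a) * \sum_i `|r i|], so one of the two values has at least half that
    size. *)
Lemma independent_lower_estimate (R : realType) (X : normedModType R)
    (T : Type) (phi : T -> dual_space X) (y : nat -> X) (a b : R) :
  (forall t, `|phi t| <= 1) -> a < b ->
  independent (fun i t => phi t (y i)) a b id ->
  forall (r : nat -> R) n,
    (b - a) / 2 * (\sum_(0 <= i < n) `|r i|)
      <= `|\sum_(0 <= i < n) r i *: y i|.
Proof.
move=> phi1 ab indep r n; set z := \sum_(0 <= i < n) r i *: y i.
have phiz t : `|phi t z| <= `|z|.
  rewrite (le_trans (le_dual_norm _ _))// ler_piMl//.
  exact: phi1.
have [t tP] := indep n (fun i => 0 <= r i).
have [u uP] := indep n (fun i => ~~ (0 <= r i)).
suff : (b - a) * (\sum_(0 <= i < n) `|r i|) <= phi t z - phi u z.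
  move=> H; have := phiz t; have := phiz u; have := ler_norm (phi t z).
  have := ler_norm (- phi u z); rewrite normrN; lra.
have phi_lin w : phi w z = \sum_(0 <= i < n) r i * phi w (y i).
  by rewrite linear_sum; apply: eq_bigr => i _; rewrite linearZ.
rewrite !phi_lin -sumrB mulr_sumr !big_nat; apply: ler_sum => i ni.
rewrite -mulrBr.
move: (tP i ni) (uP i ni); case: (lerP 0 (r i)) => ri /= ti ui.
  by rewrite ger0_norm// mulrC ler_wpM2l//; lra.
by rewrite ltr0_norm// mulrN -mulNr mulrC ler_wnM2l// ?ltW//; lra.
Qed.

(** * From the limit point to the sequence *)

(** Colour a vector by a nearby point of a countable dense set. *)
Lemma separable_colouring (R : realType) (X : normedModType R) :
  separable_space X -> forall delta : R, 0 < delta ->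
  exists c : X -> nat, forall y z, c y = c z -> `|y - z| < delta.
Proof.
move=> [D [/countable_injP[e einj] Ddense]] delta delta0.
have d20 : 0 < delta / 2 by rewrite divr_gt0.
have /choice[d dP] : forall y : X, exists d, D d /\ `|y - d| < delta / 2.
  move=> y; have [|d [yd Dd]] := Ddense (ball y (delta / 2)) _ (ball_open _ _).
    by exists y; exact: ballxx.
  by exists d; split=> //; move: yd; rewrite -ball_normE.
exists (e \o d) => y z /= edyz.
have dyz : d y = d z.
  by apply: einj; rewrite ?inE//; [exact: (dP y).1|exact: (dP z).1].
rewrite -(subrKA (d y)) (le_lt_trans (ler_normD _ _))//.
rewrite (splitr delta) ltrD//; first exact: (dP y).2.
by rewrite dyz distrC; exact: (dP z).2.
Qed.

Lemma net_limit_point_ultrafilter (I : Type) (le : I -> I -> Prop)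
    (T : topologicalType) (F : I -> T) (p : T) :
  directed_set le -> net_limit_point le F p ->
  exists U : set_system I,
    [/\ UltraFilter U, forall i, U [set j | le i j] & F @ U --> p].
Proof.
move=> [[i0] _ le_trans le_dir] Fp.
pose base (q : I * set T) := [set j | le q.1 j /\ q.2 (F j)].
pose G := filter_from [set q : I * set T | nbhs p q.2] base.
have FG : Filter G.
  apply: filter_from_filter; first by exists (i0, setT); exact: filterT.
  move=> [i A] [j B] /= pA pB; have [k [ik jk]] := le_dir i j.
  exists (k, A `&` B); first exact: filterI.
  by move=> l [/= kl [Al Bl]]; split; split=> //=;
    [exact: le_trans _ _ _ ik kl|exact: le_trans _ _ _ jk kl].
have PG : ProperFilter G.
  apply: filter_from_proper => -[i A] /= pA.
  by have [j [ij Aj]] := Fp i A pA; exists j.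
have [U [UU GU]] := ultraFilterLemma PG.
exists U; split=> // [i|A pA]; apply: GU.
  by exists (i, setT) => [|j []//]; exact: filterT.
by exists (i0, A) => // j [].
Qed.

(** The strict successors of any element contain a tail, hence are large for the
    ultrafilter; this is what makes strict increase a strategy. *)
Lemma exists_strictly_beyond (I : Type) (le : I -> I -> Prop) :
  directed_set le -> ~ has_greatest le ->
  forall i, exists j, forall k, le j k -> le i k /\ ~ le k i.
Proof.
move=> [_ _ le_trans le_dir] nogreatest i.
have /existsNP[i' ni'i] : ~ forall i', le i' i.
  by move=> gi; apply: nogreatest; exists i.
have [j [ij i'j]] := le_dir i i'.
exists j => k jk; split; first exact: le_trans _ _ _ ij jk.
by move=> ki; apply: ni'i; apply: le_trans i'j (le_trans _ _ _ jk ki).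
Qed.

(** Here the two hypotheses on [X] enter: separability provides the colouring,
    and an independent sequence in the ball would span a copy of ell_1. *)
Lemma unit_ball_thin (R : realType) (X : completeNormedModType R) (I : Type)
    (U : set_system I) (F : I -> X) (x : weak_star (dual_space X)) (eps : R) :
  separable_space X -> ~ contains_ell1 X -> UltraFilter U ->
  [bounded F i | i in setT] -> weak_star_embed \o F @ U --> x -> 0 < eps ->
  thin U (fun i (phi : {phi : dual_space X | `|phi| <= 1}) => val phi (F i))
    (fun phi => dual_fun x (val phi)) eps setT.
Proof.
move=> sepX nell1 UU /pinfty_ex_gt0[M _ FM] Fx eps0.
have PU : ProperFilter U := ultra_proper.
have /weak_star_cvgP Fxphi := Fx.
apply: contrapT => /nonthin_independent [|delta delta0|//|a [b [m [ab indep]]]].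
- by move=> phi; exact: (Fxphi (val phi)).
- have [c cP] := separable_colouring sepX delta0.
  exists (c \o F) => i j phi /cP Fij.
  rewrite -ltrBlDl -[_ - _]/(val phi (F i) - val phi (F j)) -linearB.
  rewrite (le_lt_trans (ler_norm _))// (le_lt_trans (le_dual_norm _ _))//.
  by rewrite (le_lt_trans _ Fij)// ler_piMl//; exact: (valP phi).
apply: nell1.
apply: (@contains_ell1_lower_estimate _ _ (F \o m) M ((b - a) / 2)).
- by move=> n; exact: FM.
- by rewrite divr_gt0// subr_gt0.
- exact: (independent_lower_estimate (fun phi => valP phi) ab indep).
Qed.

(* Without ~ has_greatest le the claim fails: a strictly increasing sequence
   never meets the greatest elements, so any F equal to 1 on them and to 0
   elsewhere, in X = R, has the limit point 1 but no such sequence. *)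
Theorem theorem4p3 (R : realType) (X : completeNormedModType R)
    (Gamma : Type) (le : Gamma -> Gamma -> Prop) (F : Gamma -> X) :
  separable_space X ->
  ~ contains_ell1 X ->
  directed_set le ->
  ~ has_greatest le ->
  [bounded F i | i in setT] ->
  forall x : weak_star (dual_space X),
    net_limit_point le (weak_star_embed \o F) x ->
    exists gamma : nat -> Gamma,
      strictly_increasing le gamma /\
      weak_star_embed \o F \o gamma @ \oo --> x.
Proof.
move=> sepX nell1 dir nogreatest bF x Fx.
have [U [UU Ule UF]] := net_limit_point_ultrafilter dir Fx.
have PU : ProperFilter U := ultra_proper.
have Ubeyond i : U [set k | le i k /\ ~ le k i].
  have [j jP] := exists_strictly_beyond dir nogreatest i.
  by apply: filterS (Ule j).
have eps0 (n : nat) : 0 < n.+1%:R^-1 :> R by rewrite invr_gt0.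
have /choice[Phi PhiP] := fun n => unit_ball_thin sepX nell1 UU bF UF (eps0 n).
(* After each move, open the strategy for the next tolerance and require all
   later moves to be strictly beyond the move just made. *)
pose W p s := Phi (size p) s `&`
  (if rev p is i :: _ then [set k | le i k /\ ~ le k i] else setT).
have [p s|Psi [UPsi PsiW]] := @strategy_fusion Gamma U _ W.
  apply: filterI; first exact: (PhiP _).1.
  by case: (rev p) => [|i _]; [exact: filterT|exact: Ubeyond].
have [gamma /PsiW gammaW] := exists_follows (fun s => filter_ex (UPsi s)).
exists gamma; split=> [n|].
  have := gammaW n.+1 0%N; rewrite /W mkseqS rev_rcons addn0 => -[_].
  exact.
apply: (@weak_star_embed_cvg _ _ (F \o gamma)) => eps eps_gt0 phi phi1.
have [n neps] : exists n : nat, n.+1%:R^-1 <= eps.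
  exists (Num.truncn eps^-1); rewrite -[leRHS]invrK lef_pV2 ?posrE ?invr_gt0//.
  exact/ltW/truncnS_gt.
apply: (@eventually_shift n).
have gammaPhi : follows (Phi n) (fun k => gamma (n + k)%N).
  by move=> k; have [] := gammaW n k; rewrite size_mkseq.
apply: filterS ((PhiP n).2 _ gammaPhi (exist _ phi phi1) I) => k /= /le_trans.
by apply; rewrite lerD2l.
Qed.
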